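(* Let $H=(V,E)$ be a connected finite hypergraph with vertex measure $\mu$ and hyperedge weight $\omega$. If a function $\phi:V\to\mathbb{R}$ satisfies $-\Delta\phi\ge0$ on $V$, then $\phi^-$ is a constant function on $V$, where $\phi^-=\min\{\phi,0\}$.
   Context: A (finite, undirected) hypergraph $H=(V,E)$ consists of a finite vertex set $V$ and a set $E$ of hyperedges, each hyperedge $e\in E$ being a subset of $V$ with cardinality $\delta_e:=|e|$ satisfying $2\le\delta_e\le|V|$. $H$ is connected if for any two different vertices $v,v'$ there is a sequence of hyperedges $e_1,\dots,e_l\in E$ with $v\in e_1$, $v'\in e_l$ and $e_n\cap e_{n+1}\ne\emptyset$ for $1\le n\le l-1$. The measure is a function $\mu:V\to(0,\infty)$ and the weight is a function $\omega:E\to(0,\infty)$, written $\omega_e=\omega(e)$. The Laplace operator (divergence of the hypergraph gradient) of $\phi:V\to\mathbb{R}$ is given explicitly by $$\Delta\phi(v)=\frac{1}{\mu(v)}\sum_{e\in E:\,v\in e}\frac{\omega_e}{\delta_e-1}\sum_{u\in e:\,u\ne v}(\phi(u)-\phi(v)),\quad v\in V.$$ *)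

(* Defs.v *)
From HB Require Import structures.
From mathcomp Require Import all_boot all_order all_algebra.
From mathcomp Require Import reals.

Set Implicit Arguments.
Unset Strict Implicit.
Unset Printing Implicit Defensive.

Import Order.TTheory GRing.Theory Num.Theory.
Local Open Scope ring_scope.

(* The upper bound #|e| <= #|V| on hyperedge sizes is automatic. *)
Record hypergraph (V : finType) := Hypergraph {
  hedges : {set {set V}};
  hedge_card : forall e : {set V}, e \in hedges -> (2 <= #|e|)%N
}.

(* The sequence of hyperedges e_1, ..., e_l is represented by e_1 :: s. *)
Definition hconnected (V : finType) (H : hypergraph V) : Prop :=
  forall v v' : V, v != v' ->
    exists (e1 : {set V}) (s : seq {set V}),
      [/\ {subset e1 :: s <= hedges H},
          v \in e1,
          v' \in last e1 s
        & path (fun e f : {set V} => e :&: f != set0) e1 s].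

(* Only the values of the weight w on the hyperedges of H are used. *)
Definition laplacian (R : realType) (V : finType) (H : hypergraph V)
    (mu : V -> R) (w : {set V} -> R) (phi : V -> R) (v : V) : R :=
  (mu v)^-1 *
  \sum_(e in hedges H | v \in e)
     w e / (#|e|%:R - 1) * \sum_(u in e | u != v) (phi u - phi v).

Definition negpart (R : realType) (V : finType) (phi : V -> R) (v : V) : R :=
  Num.min (phi v) 0.

(* Main.v *)
Require Import Defs.
From HB Require Import structures.
From mathcomp Require Import all_boot all_order all_algebra.
From mathcomp Require Import reals.

Set Implicit Arguments.
Unset Strict Implicit.
Unset Printing Implicit Defensive.

Import Order.TTheory GRing.Theory Num.Theory.
Local Open Scope ring_scope.

(** The proof is the minimum principle for superharmonic functions.  At a vertex
    where [phi] attains its minimum over [V], every increment [phi u - phi v]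
    is nonnegative, so the Laplacian there is a sum of nonnegative terms with
    positive weights; superharmonicity makes that sum nonpositive, hence every
    increment vanishes and [phi] keeps its minimal value on each hyperedge
    through the vertex ([superharmonic_min_edge]).  The set of minimizers thus
    absorbs every hyperedge that it meets, and in a connected hypergraph such a
    set, being nonempty, is all of [V] ([absorbing_walk]).  As [V] is finite a
    minimizer exists unless [V] is empty, so [phi] itself is constant, and with
    it its negative part. *)

(** The factors [#|e| - 1] are positive because hyperedges have at least two
    vertices, so a vanishing Laplacian at a minimizer forces every summand to
    vanish. *)
Lemma superharmonic_min_edge (R : realType) (V : finType) (H : hypergraph V)
    (mu : V -> R) (w : {set V} -> R) (phi : V -> R) (v : V) :
  0 < mu v -> (forall e, e \in hedges H -> 0 < w e) ->
  0 <= - laplacian H mu w phi v -> (forall u, phi v <= phi u) ->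
  forall e, e \in hedges H -> v \in e -> forall u, u \in e -> phi u = phi v.
Proof.
move=> mu_gt0 w_gt0; rewrite oppr_ge0 => lap_le0 v_min e eH ve u ue.
have coef_gt0 f : f \in hedges H -> 0 < w f / (#|f|%:R - 1).
  move=> fH; rewrite divr_gt0 ?w_gt0 // subr_gt0 ltr1n.
  exact: hedge_card fH.
have incr_ge0 x : 0 <= phi x - phi v by rewrite subr_ge0.
have term_ge0 f : (f \in hedges H) && (v \in f) ->
    0 <= w f / (#|f|%:R - 1) * \sum_(x in f | x != v) (phi x - phi v).
  case/andP=> fH _; rewrite mulr_ge0 ?sumr_ge0 //.
  exact: ltW (coef_gt0 f fH).
have [->//|u_neq_v] := eqVneq u v.
have sum_eq0 : \sum_(f in hedges H | v \in f)
    w f / (#|f|%:R - 1) * \sum_(x in f | x != v) (phi x - phi v) = 0.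
  apply/eqP; rewrite eq_le sumr_ge0 // andbT.
  by move: lap_le0; rewrite /laplacian pmulr_rle0 ?invr_gt0.
have := psumr_eq0P term_ge0 sum_eq0 (i := e).
rewrite eH ve => /(_ isT) /eqP; rewrite mulf_eq0 gt_eqF ?coef_gt0 //= => /eqP.
move=> /(psumr_eq0P (fun x _ => incr_ge0 x)) /(_ u).
by rewrite ue u_neq_v => /(_ isT) /eqP; rewrite subr_eq0 => /eqP.
Qed.

(** Connectedness is given by walks of successively intersecting hyperedges: a
    vertex shared by two consecutive hyperedges carries membership in [A] from
    one to the next. *)
Lemma absorbing_walk (V : finType) (E : {set {set V}}) (A : {pred V}) :
  (forall e v, e \in E -> v \in e -> v \in A -> {subset e <= A}) ->
  forall e s v, {subset e :: s <= E} ->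
    path (fun f g : {set V} => f :&: g != set0) e s ->
    v \in e -> v \in A -> {subset last e s <= A}.
Proof.
move=> absA e s; elim: s e => [|f s IHs] e v sE.
  by move=> _ ve vA; apply: (absA e v) => //; apply: sE; rewrite mem_head.
case/andP=> /set0Pn[x /setIP[xe xf]] walk ve vA /=.
apply: (IHs f x) => //; first by move=> g gs; apply: sE; rewrite inE gs orbT.
by apply: (absA e v) => //; apply: sE; rewrite mem_head.
Qed.

Theorem lemma3p2 (R : realType) (V : finType) (H : hypergraph V)
    (mu : V -> R) (w : {set V} -> R) (phi : V -> R)
    (Hconn : hconnected H)
    (mu_gt0 : forall v : V, 0 < mu v)
    (w_gt0 : forall e : {set V}, e \in hedges H -> 0 < w e)
    (Hphi : forall v : V, 0 <= - laplacian H mu w phi v) :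
  exists c : R, forall v : V, negpart phi v = c.
Proof.
case: (pickP (fun _ : V => true)) => [v0 _|V_empty]; last first.
  by exists 0 => v; have := V_empty v.
have [m _ m_min] := arg_minP phi (erefl : xpredT v0).
have absorbing e v : e \in hedges H -> v \in e ->
    v \in [pred x | phi x == phi m] -> {subset e <= [pred x | phi x == phi m]}.
  move=> eH ve /eqP phi_v u ue; rewrite inE -phi_v; apply/eqP.
  apply: (superharmonic_min_edge (mu_gt0 v) w_gt0 (Hphi v) _ eH ve ue) => x.
  by rewrite phi_v m_min.
exists (negpart phi m) => v; rewrite /negpart.
have [->//|m_neq_v] := eqVneq m v.
have [e [s [sE me vs walk]]] := Hconn m v m_neq_v.
have := absorbing_walk absorbing sE walk me (eqxx _) vs.
by rewrite inE => /eqP ->.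
Qed.
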